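(* Let $G=(V,E)$ be a non-bipartite, finite, simple, connected graph, and let $\Theta=D+A$ be its combinatorial signless Laplacian, with largest eigenvalue $\lambda_{\max}^\Theta$. Then for each $\delta\in[0,\lambda_{\max}^\Theta)$ and $x\in V$, $$\mu_x^\Theta(\delta)\le\frac{\delta}{\mathscr K(G)}\le(\mathrm{diam}(G)+1)\,\delta.$$
   Context: Graphs are undirected and unweighted; $A$ is the adjacency matrix, $D$ the diagonal degree matrix, $\mathrm{diam}(G)$ the graph diameter. $\Theta$ is self-adjoint and positive semidefinite on $\ell^2(V)$ with the standard inner product; $I_\Theta([0,\delta])$ is the orthogonal projection onto the span of eigenvectors of $\Theta$ with eigenvalues in $[0,\delta]$, and the vertex spectral measure is $\mu_x^\Theta(\delta)=\langle I_\Theta([0,\delta])\mathbf 1_x,\mathbf 1_x\rangle$, where $\mathbf 1_x$ is the indicator vector of $x$. The graph parameter $\mathscr K(G)$ is $$\mathscr K(G):=\min\left\{\frac{\sum_{(v,u)\in E}|f(v)+f(u)|^2}{\max_{y\in V}|f(y)|^2}\ :\ f\colon V\to\mathbb R,\ \min_{y\in V}f(y)<0<\max_{y\in V}f(y)\right\},$$ where the sum counts each edge once. *)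

(* Defs.v *)
From HB Require Import structures.
From mathcomp Require Import all_boot all_order all_algebra.
From mathcomp Require Import all_classical all_reals.
Set Implicit Arguments.
Unset Strict Implicit.
Unset Printing Implicit Defensive.
Import Order.TTheory GRing.Theory Num.Theory.
Local Open Scope classical_set_scope.
Local Open Scope ring_scope.

(* The least (greatest) *element* of a set of reals; 0 if there is none. *)
Definition minimum (R : realType) (A : set R) : R := xget 0 (A `&` lbound A).
Definition maximum (R : realType) (A : set R) : R := xget 0 (A `&` ubound A).

Lemma minimumE (R : realType) (A : set R) (m : R) :
  A m -> lbound A m -> minimum A = m.
Proof.
move=> Am mA; have [A' A'm] : (A `&` lbound A) (minimum A).
  by apply: xgetPex; exists m.
by apply/eqP; rewrite eq_le A'm // mA.
Qed.

Lemma maximumE (R : realType) (A : set R) (m : R) :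
  A m -> ubound A m -> maximum A = m.
Proof.
move=> Am mA; have [A' A'm] : (A `&` ubound A) (maximum A).
  by apply: xgetPex; exists m.
by apply/eqP; rewrite eq_le A'm // mA.
Qed.

(* A simple graph is a symmetric irreflexive relation e on a finType V. *)
Definition bipartite (V : finType) (e : rel V) : Prop :=
  exists c : V -> bool, forall u v, e u v -> c u != c v.

(* A path with k edges from x to y is a k-tuple p with path e x p ending at y;
   in a connected graph some k < #|V| always works. *)
Definition gdist (V : finType) (e : rel V) (x y : V) : nat :=
  find (fun k => [exists p : k.-tuple V, path e x p && (last x p == y)])
       (iota 0 #|V|).

Definition diam (V : finType) (e : rel V) : nat :=
  \max_(x : V) \max_(y : V) gdist e x y.

Definition degree (V : finType) (e : rel V) (v : V) : nat := #|[pred u | e v u]|.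

(* l^2(V) is identified with 'rV[R]_#|V| through enum_rank / enum_val; operators
   act on row vectors on the right, v |-> v *m T.  All operators below are real
   symmetric, so real scalars lose no spectral information. *)
Section Spectral.
Variables (R : realType) (V : finType) (e : rel V).

Definition adjacency : 'M[R]_#|V| :=
  \matrix_(i, j) (e (enum_val i) (enum_val j))%:R.

Definition degree_mx : 'M[R]_#|V| :=
  diag_mx (\row_i (degree e (enum_val i))%:R).

Definition signless_laplacian : 'M[R]_#|V| := degree_mx + adjacency.

Definition indicator (x : V) : 'rV[R]_#|V| := delta_mx 0 (enum_rank x).

End Spectral.

Definition inner (R : realType) (n : nat) (u v : 'rV[R]_n) : R :=
  \sum_i u 0 i * v 0 i.

(* kermx W^T has row space { u | u is orthogonal to every row of W }. *)
Definition orth_compl (R : realType) (n : nat) (W : 'M[R]_n) : 'M[R]_n :=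
  kermx W^T.

Definition orth_proj (R : realType) (n : nat) (W : 'M[R]_n) : 'M[R]_n :=
  proj_mx W (orth_compl W).

Lemma innerE (R : realType) (n : nat) (u v : 'rV[R]_n) :
  inner u v = (u *m v^T) 0 0.
Proof. by rewrite mxE; apply: eq_bigr => i _; rewrite mxE. Qed.

Lemma inner_eq0 (R : realType) (n : nat) (u : 'rV[R]_n) :
  inner u u = 0 -> u = 0.
Proof.
move=> /eqP; rewrite psumr_eq0 => [|i _]; last by rewrite -expr2 sqr_ge0.
move=> /allP h; apply/rowP => i; rewrite mxE.
by have := h i (mem_index_enum i); rewrite -expr2 sqrf_eq0 => /eqP.
Qed.

Lemma orth_complP (R : realType) (n : nat) (W : 'M[R]_n) (u : 'rV[R]_n) :
  (u <= orth_compl W)%MS <-> (forall w : 'rV_n, (w <= W)%MS -> inner u w = 0).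
Proof.
split=> [/sub_kermxP uW w /submxP[D ->]|h].
  by rewrite innerE trmx_mul mulmxA uW mul0mx mxE.
apply/sub_kermxP/rowP => i; rewrite [RHS]mxE -(h _ (row_sub i W)) mxE.
by apply: eq_bigr => j _; rewrite !mxE.
Qed.

Lemma orth_proj_spec (R : realType) (n : nat) (W : 'M[R]_n) (u : 'rV[R]_n) :
  (u *m orth_proj W <= W)%MS /\
  (forall w : 'rV_n, (w <= W)%MS -> inner (u - u *m orth_proj W) w = 0).
Proof.
split; first exact: proj_mx_sub.
apply/orth_complP; apply: proj_mx_compl_sub.
have dxW : (W :&: orth_compl W)%MS = 0.
  apply/eqP/rowV0P => v; rewrite sub_capmx => /andP[vW /orth_complP vW'].
  exact/inner_eq0/vW'.
rewrite -[X in (X <= _)%MS]mulmx1; apply: submx_trans (submxMl _ _) _.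
rewrite sub1mx -col_leq_rank (mxdirectP _) /=; last by apply/mxdirect_addsP.
by rewrite mxrank_ker mxrank_tr subnKC ?rank_leq_row.
Qed.

(* The span of the eigenvectors of T with eigenvalue in [0, delta].  The sum
   ranges over all reals a in [0, delta]; only eigenvalues contribute, since
   eigenspace T a = 0 otherwise. *)
Definition spectral_subspace (R : realType) (n : nat) (T : 'M[R]_n) (delta : R)
    : 'M[R]_n :=
  \big[addsmx/0]_(a \in [set a : R | 0 <= a <= delta]) eigenspace T a.

Lemma spectral_subspace_eigenvector (R : realType) (n : nat) (T : 'M[R]_n)
    (delta a : R) (v : 'rV[R]_n) :
  0 <= a <= delta -> v *m T = a *: v -> (v <= spectral_subspace T delta)%MS.
Proof.
move=> a_delta /eigenspaceP va; have [->|v0] := eqVneq v 0; first exact: sub0mx.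
have ea0 : eigenspace T a != 0.
  by apply: contraNneq v0 => E; rewrite E submx0 in va.
have fin : finite_set
    ([set b : R | 0 <= b <= delta] `&` eigenspace T @^-1` [set~ 0]).
  have [s sE] : exists s : seq R, forall b, eigenvalue T b -> b \in s.
    apply: contrapT => /forallNP h.
    have [s us [ss alls]] : exists2 s : seq R, uniq s &
        size s = size (char_poly T) /\ all (root (char_poly T)) s.
      elim: (size _) => [|k [s us [sk rs]]]; first by exists [::].
      have /existsNP[b /not_implyP[eb /negP bs]] := h s.
      by exists (b :: s); rewrite /= ?bs ?us // sk -eigenvalue_root_char eb.
    have := max_poly_roots (monic_neq0 (char_poly_monic T)) alls us.
    by rewrite ss ltnn.
  apply: (sub_finite_set _ (finite_seq s)) => b [_ /eqP eb].
  exact: sE.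
apply: submx_trans va _.
rewrite /spectral_subspace (bigD1_seq a) ?finite_support_uniq //=.
  exact: addsmxSl.
by rewrite in_finite_support // inE; split=> //; apply/eqP.
Qed.

Definition spectral_proj (R : realType) (n : nat) (T : 'M[R]_n) (delta : R)
    : 'M[R]_n :=
  orth_proj (spectral_subspace T delta).

Definition spectral_measure (R : realType) (V : finType) (T : 'M[R]_#|V|)
    (x : V) (delta : R) : R :=
  inner (indicator R x *m spectral_proj T delta) (indicator R x).

Definition max_eigenvalue (R : realType) (n : nat) (T : 'M[R]_n) : R :=
  maximum [set a | eigenvalue T a].

(* Each unordered edge is counted once, by its enum_rank-increasing
   orientation. *)
Definition edge_energy (R : realType) (V : finType) (e : rel V) (f : V -> R)
    : R :=
  \sum_(v : V) \sum_(u : V | e v u && (enum_rank v < enum_rank u)%N)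
    `|f v + f u| ^+ 2.

Definition graphK (R : realType) (V : finType) (e : rel V) : R :=
  minimum [set edge_energy e f / maximum (range (fun y => `|f y| ^+ 2))
          | f in [set f : V -> R | minimum (range f) < 0 < maximum (range f)]].

(* Main.v *)
Require Import Defs.
From mathcomp Require Import all_boot all_order all_algebra.
From mathcomp Require Import all_classical all_reals.
From mathcomp Require Import zify ring lra.
Import Order.TTheory GRing.Theory Num.Theory.
Local Open Scope ring_scope.

(** Write T = D + A, so that <T f, f> is the sum E(f) of (f v + f u)^2 over the
    edges.  Since the graph is not bipartite, for each y some edge ab joins two
    vertices at the same distance k from y; the geodesic from y to a, or the one
    to b continued by ba, gives an alternating sum of at most k + 1 terms
    f v + f u that is at least |f y|, whence f(y)^2 <= (diam + 1) E(f).
    In particular T is invertible.  With g_y = T^-1 1_y and c_y = g_y(y) = E(g_y),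
    Cauchy-Schwarz gives f(y)^2 <= c_y E(f), with equality at f = g_y; as g_y
    always changes sign, K(G) = 1 / max_y c_y, hence the second inequality.
    For the first one take f to be the spectral projection of 1_x: then
    |f|^2 = f(x) is the spectral measure, and
    f(x)^2 <= E(f) / K <= delta |f|^2 / K = delta f(x) / K. *)

(** * Graph distance, geodesics and edges inside a distance level *)

Section GraphDistance.
Context {V : finType} {e : rel V}.
Implicit Types (x y u v : V) (p : seq V).

Lemma gdist_le_size x p : path e x p -> (gdist e x (last x p) <= size p)%N.
Proof.
move=> xp; rewrite /gdist.
set a := (fun k : nat => _); rewrite leqNgt; apply/negP => lt_p.
(* [find] never exceeds [#|V|], so a walk shorter than [gdist] lies in the searched range. *)
have szp : (size p < #|V|)%N.
  by apply: leq_trans lt_p _; rewrite -[leqRHS](size_iota 0) find_size.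
have := before_find 0%N lt_p; rewrite nth_iota // add0n => /negbT/negP[].
by rewrite /a; apply/existsP; exists (in_tuple p); rewrite /= xp eqxx.
Qed.

Hypothesis e_conn : forall u v : V, connect e u v.

Lemma gdist_path x y :
  exists p, [/\ path e x p, last x p = y, uniq (x :: p) & size p = gdist e x y].
Proof.
have [p0 xp0 [yp0 szp0]] :
    exists2 p, path e x p & last x p = y /\ (size p < #|V|)%N.
  have /connectP[p xp ->] := e_conn x y; case/shortenP: xp => p' xp' up' _.
  by exists p' => //; split=> //; move/card_uniqP: up' => /= <-; exact: max_card.
have [p [xp yp szp]] : exists p,
    [/\ path e x p, last x p = y & size p = gdist e x y].
  have hs : has (fun k => [exists p : k.-tuple V, path e x p && (last x p == y)])
      (iota 0 #|V|).
    apply/hasP; exists (size p0); first by rewrite mem_iota.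
    by apply/existsP; exists (in_tuple p0); rewrite /= xp0 yp0 eqxx.
  have lt := hs; rewrite has_find size_iota in lt.
  have := nth_find 0%N hs; rewrite nth_iota // add0n.
  by case/existsP => p /andP[xp /eqP yp]; exists p; split; rewrite ?size_tuple.
(* Removing loops cannot shorten this walk, since its length is already the distance. *)
case/shortenP: xp yp => p' xp' up' sp' yp'; exists p'; split=> //.
apply/eqP; rewrite eqn_leq -{2}yp' gdist_le_size // andbT -szp.
by apply: uniq_leq_size sp'; case/andP: up'.
Qed.

Lemma gdist_edge x u v : e u v -> (gdist e x v <= (gdist e x u).+1)%N.
Proof.
have [p [xp <- _ <-]] := gdist_path x u => uv.
have xpv : path e x (rcons p v) by rewrite rcons_path xp.
by have := gdist_le_size _ _ xpv; rewrite last_rcons size_rcons.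
Qed.

Lemma gdist_le_diam x y : (gdist e x y <= diam e)%N.
Proof.
apply: leq_trans (leq_bigmax x); exact: (leq_bigmax (F := gdist e x) y).
Qed.

Hypotheses (e_sym : symmetric e) (e_irr : irreflexive e).

(** Otherwise the parity of the distance to [x] would be a proper 2-colouring, since distances of
    adjacent vertices differ by at most one. *)
Lemma level_edge x : ~ bipartite e ->
  exists a b, e a b /\ gdist e x a = gdist e x b.
Proof.
move=> nb; apply: contrapT => h; apply: nb.
exists (fun v => odd (gdist e x v)) => u v uv; apply/negP => /eqP odduv.
apply: h; exists u, v; split=> //.
have := gdist_edge x _ _ uv; rewrite e_sym in uv.
have := gdist_edge x _ _ uv; lia.
Qed.

(** If [b] lay on the geodesic to [a], the prefix ending at [b] would already have full length,
    forcing [a = b]. *)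
Lemma uniq_path_level_edge x a b : e a b -> gdist e x a = gdist e x b ->
  exists p, [/\ path e x p, last x p = a, uniq (x :: rcons p b)
              & size p = gdist e x a].
Proof.
move=> ab eq_ab; have [p [xp xpa up szp]] := gdist_path x a.
exists p; split=> //; rewrite -rcons_cons rcons_uniq up andbT.
apply/negP => bp; have a_neq_b : a != b by apply: contraTneq ab => ->; rewrite e_irr.
move: bp xp xpa szp a_neq_b; case/splitPl => p1 p2 xb.
rewrite cat_path last_cat size_cat xb => /andP[xp1 _] p2a.
rewrite eq_ab => szp a_neq_b; have := gdist_le_size _ _ xp1; rewrite xb -szp.
case: p2 p2a {szp} => [/= ba|z p2 _ /=]; last by lia.
by rewrite ba eqxx in a_neq_b.
Qed.

End GraphDistance.

(** * Edge energy along paths and the diameter bound *)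

Section Energy.
Context {R : realType} {V : finType} {e : rel V}.
Hypotheses (e_sym : symmetric e) (e_irr : irreflexive e).
Implicit Types (f : V -> R) (x y : V) (p s : seq V).

Lemma edge_energy_double f :
  edge_energy e f *+ 2 = \sum_v \sum_(u | e v u) (f v + f u) ^+ 2.
Proof.
have normE v u : `|f v + f u| ^+ 2 = (f v + f u) ^+ 2 by rewrite real_normK ?num_real.
transitivity (\sum_v (\sum_(u | e v u && (enum_rank v < enum_rank u)%N)
    (f v + f u) ^+ 2 + \sum_(u | e v u && ~~ (enum_rank v < enum_rank u)%N)
    (f v + f u) ^+ 2)); last by apply: eq_bigr => v _; rewrite -bigID.
rewrite big_split /= mulr2n; congr (_ + _).
  by apply: eq_bigr => v _; apply: eq_bigr => u _.
rewrite /edge_energy pair_big_dep /= [RHS]pair_big_dep /=.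
rewrite (reindex (fun q : V * V => (q.2, q.1))) /=; last first.
  by exists (fun q : V * V => (q.2, q.1)) => -[].
apply: eq_big => [[v u]|[v u] _] /=; last by rewrite normE addrC.
rewrite e_sym; case vu: (e v u) => //=.
rewrite -leqNgt ltn_neqAle; case: eqVneq => //= /val_inj/enum_rank_inj uv.
by rewrite uv e_irr in vu.
Qed.

Lemma edge_energy_ge0 f : 0 <= edge_energy e f.
Proof. by apply: sumr_ge0 => v _; apply: sumr_ge0 => u _; exact: exprn_ge0. Qed.

Definition path_energy f x p : R :=
  \sum_(q <- zip (x :: p) p) (f q.1 + f q.2) ^+ 2.

Lemma path_energy_cons f x y p :
  path_energy f x (y :: p) = (f x + f y) ^+ 2 + path_energy f y p.
Proof. by rewrite /path_energy /= big_cons. Qed.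

(** After doubling, each pair of consecutive vertices occurs in both orders among the ordered
    adjacent pairs of path vertices; all other terms are nonnegative. *)
Lemma path_energy_le f x p : path e x p -> uniq (x :: p) ->
  path_energy f x p <= edge_energy e f.
Proof.
move=> xp up; pose h v u : R := if e v u then (f v + f u) ^+ 2 else 0.
have h0 v u : 0 <= h v u by rewrite /h; case: ifP => // _; exact: sqr_ge0.
have hS v u : h v u = h u v by rewrite /h e_sym addrC.
have le_seq : path_energy f x p *+ 2 <=
    \sum_(v <- x :: p) \sum_(u <- x :: p) h v u.
  elim: p x xp {up} => [|z p IHp] x /=.
    by rewrite /path_energy big_nil mul0rn => _; do 2!(apply: sumr_ge0 => ? _).
  case/andP=> xz /IHp; rewrite path_energy_cons => le_zp.
  rewrite big_cons.
  have -> : \sum_(v <- z :: p) \sum_(u <- [:: x, z & p]) h v u =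
      \sum_(v <- z :: p) h v x + \sum_(v <- z :: p) \sum_(u <- z :: p) h v u.
    by rewrite -big_split /=; apply: eq_bigr => v _; rewrite big_cons.
  rewrite addrA mulrnDl; apply: lerD => //.
  have -> : (f x + f z) ^+ 2 = h x z by rewrite /h xz.
  rewrite mulr2n; apply: lerD.
    rewrite !big_cons; have s0 : 0 <= \sum_(u <- p) h x u by exact: sumr_ge0.
    by have := h0 x x; lra.
  rewrite big_cons hS lerDl; exact: sumr_ge0.
rewrite -(ler_pMn2r (n := 2)) // edge_energy_double.
apply: le_trans le_seq _.
(* Simplicity of the path turns sums over the list into sums over a set of vertices. *)
rewrite big_uniq //= [leRHS](bigID (mem (x :: p))) /= -[leLHS]addr0.
apply: lerD; last by do 2!(apply: sumr_ge0 => ? _); exact: sqr_ge0.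
apply: ler_sum => v _; rewrite big_uniq //= [leRHS]big_mkcond /=.
rewrite [leRHS](bigID (mem (x :: p))) /= lerDl; apply: sumr_ge0 => u _.
exact: h0.
Qed.

(* The left-hand side telescopes into the alternating sum of the [f v + f u]
   along the path; Cauchy-Schwarz does the rest. *)
Lemma alternating_path f x p :
  (f x - (-1) ^+ size p * f (last x p)) ^+ 2 <= (size p)%:R * path_energy f x p.
Proof.
elim: p x => [|z p IHp] x /=.
  by rewrite expr0 mul1r subrr expr0n mul0r.
rewrite path_energy_cons [(-1) ^+ _.+1]exprS.
have := IHp z; set B := f z - _ => le_B.
have -> : f x - -1 * (-1) ^+ size p * f (last z p) = (f x + f z) - B.
  by rewrite /B; ring.
set A := f x + f z; move: le_B; set P := path_energy _ _ _.
(* With no edge left the bound forces [B = 0]; otherwise one may multiply by [K = k + 1], and the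
   gap becomes the square of [K * A + B]. *)
case: (size p) => [|k] le_B.
  have : B ^+ 2 = 0 by apply/le_anti; rewrite sqr_ge0 andbT; lra.
  have P0 : 0 <= P by apply: sumr_ge0 => *; exact: sqr_ge0.
  by move/eqP; rewrite sqrf_eq0 => /eqP ->; rewrite subr0 mul1r lerDl.
have k0 : 0 < k.+1%:R :> R by [].
rewrite -[k.+2]addn1 natrD; move: k.+1%:R k0 le_B => K K0 le_B.
rewrite -(ler_pM2l K0).
have sq : 0 <= (K * A + B) ^+ 2 by exact: sqr_ge0.
have le_B' : (K + 1) * B ^+ 2 <= (K + 1) * (K * P).
  by rewrite ler_pM2l // addr_gt0.
have -> : K * ((K + 1) * (A ^+ 2 + P)) = K * (K + 1) * A ^+ 2 + (K + 1) * (K * P).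
  by ring.
apply: le_trans (lerD (lexx _) le_B'); rewrite -subr_ge0.
by have -> : K * (K + 1) * A ^+ 2 + (K + 1) * B ^+ 2 - K * (A - B) ^+ 2
  = (K * A + B) ^+ 2 by ring.
Qed.

(** The sign condition makes the product of [f x] and the signed end term nonpositive, so
    subtracting that term cannot shrink the square. *)
Lemma sqr_le_path f x p : path e x p -> uniq (x :: p) ->
  0 <= - ((-1) ^+ size p * f (last x p)) * f x ->
  f x ^+ 2 <= (size p)%:R * edge_energy e f.
Proof.
move=> xp up; have := alternating_path f x p.
set t := _ * f _ => le_t t0.
apply: (@le_trans _ _ ((f x - t) ^+ 2)); first by have := sqr_ge0 t; nra.
by apply: le_trans le_t _; apply: ler_wpM2l => //; exact: path_energy_le.
Qed.

(* Let [ab] be an edge inside the level set [k] of the distance to [x].  If the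
   geodesic to [a], of length [k], has the wrong sign for [sqr_le_path], then
   the geodesic to [b] followed by [ba], of length [k + 1], has the right one. *)
Lemma sqr_le_diam (e_conn : forall u v : V, connect e u v)
    (e_nbip : ~ bipartite e) f x :
  f x ^+ 2 <= ((diam e)%:R + 1) * edge_energy e f.
Proof.
have [a [b [ab eq_ab]]] := level_edge e_conn e_sym x e_nbip.
have walk c d : e c d -> gdist e x c = gdist e x d ->
    0 <= - ((-1) ^+ gdist e x c * f c) * f x \/
    0 <= ((-1) ^+ gdist e x c * f d) * f x ->
    f x ^+ 2 <= ((diam e)%:R + 1) * edge_energy e f.
  move=> cd eq_cd sgn.
  have [p [xp xpc up szp]] := uniq_path_level_edge e_conn e_irr x c d cd eq_cd.
  have bound q : path e x q -> uniq (x :: q) -> (size q <= (diam e).+1)%N ->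
      0 <= - ((-1) ^+ size q * f (last x q)) * f x ->
      f x ^+ 2 <= ((diam e)%:R + 1) * edge_energy e f.
    move=> xq uq szq sq; apply: le_trans (sqr_le_path f x q xq uq sq) _.
    by apply: ler_wpM2r; rewrite ?edge_energy_ge0 // natr1 ler_nat.
  have le_d := @gdist_le_diam _ e x c.
  case: sgn => sgn.
    apply: (bound p) => //; rewrite ?szp ?xpc //; last exact: leqW.
    by move: up; rewrite -rcons_cons rcons_uniq => /andP[].
  apply: (bound (rcons p d)); rewrite ?rcons_path ?xp ?xpc //.
    by rewrite size_rcons szp.
  by rewrite size_rcons szp last_rcons exprS mulN1r !mulNr opprK.
have [s|s] := leP 0 (- ((-1) ^+ gdist e x a * f a) * f x).
  by apply: (walk a b) => //; left.
apply: (walk b a); rewrite ?[e b a]e_sym -?eq_ab //; right; lra.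
Qed.

End Energy.

(** * Inner product and Rayleigh bound on spectral subspaces *)

Section Inner.
Context {R : realType} {n : nat}.
Implicit Types u v w : 'rV[R]_n.

Lemma innerC u v : inner u v = inner v u.
Proof. by apply: eq_bigr => i _; rewrite mulrC. Qed.

Lemma innerDl u v w : inner (u + v) w = inner u w + inner v w.
Proof. by rewrite !innerE mulmxDl mxE. Qed.

Lemma innerDr u v w : inner u (v + w) = inner u v + inner u w.
Proof. by rewrite innerC innerDl !(innerC _ u). Qed.

Lemma innerZl (a : R) u v : inner (a *: u) v = a * inner u v.
Proof. by rewrite !innerE -scalemxAl mxE. Qed.

Lemma innerZr (a : R) u v : inner u (a *: v) = a * inner u v.
Proof. by rewrite innerC innerZl innerC. Qed.

Lemma inner_mulmx (T : 'M[R]_n) u v : inner (u *m T) v = inner u (v *m T^T).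
Proof. by rewrite !innerE trmx_mul trmxK mulmxA. Qed.

Lemma inner_delta u (i : 'I_n) : inner u (delta_mx 0 i) = u 0 i.
Proof. by rewrite innerE trmx_delta -colE mxE. Qed.

Lemma inner_ge0 u : 0 <= inner u u.
Proof. by apply: sumr_ge0 => i _; rewrite -expr2 sqr_ge0. Qed.

Variable T : 'M[R]_n.
Hypothesis T_sym : T^T = T.

(** By symmetry [a * inner u v1 = b * inner u v1] for [v1] in the eigenspace of [b], and
    [a != b]. *)
Lemma eigenspace_orth (a : R) (s : seq R) u v : a \notin s ->
  (u <= eigenspace T a)%MS -> (v <= \sum_(b <- s) eigenspace T b)%MS ->
  inner u v = 0.
Proof.
move=> + /eigenspaceP ua; elim: s v => [|b s IHs] v.
  by rewrite big_nil submx0 innerE => _ /eqP ->; rewrite trmx0 mulmx0 mxE.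
rewrite in_cons negb_or big_cons => /andP[ab /IHs{}IHs].
case/sub_addsmxP => -[w1 w2] /= ->.
set v1 := w1 *m _; have /eigenspaceP v1b : (v1 <= eigenspace T b)%MS.
  exact: submxMl.
rewrite innerDr (IHs (w2 *m _)) ?submxMl // addr0.
have := inner_mulmx T u v1; rewrite T_sym ua v1b innerZl innerZr => /eqP.
by rewrite -subr_eq0 -mulrBl mulf_eq0 subr_eq0 (negbTE ab) => /eqP.
Qed.

(** Peeling off one eigenspace at a time, the cross terms vanish by orthogonality. *)
Lemma rayleigh_eigenspaces (delta : R) (s : seq R) u :
  uniq s -> {in s, forall a, a <= delta} ->
  (u <= \sum_(a <- s) eigenspace T a)%MS ->
  inner (u *m T) u <= delta * inner u u.
Proof.
elim: s u => [|a s IHs] u.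
  by rewrite big_nil submx0 innerE => _ _ /eqP ->; rewrite innerE !mul0mx mxE mulr0.
rewrite big_cons => /andP[a_s us] le_s /sub_addsmxP[[w1 w2] /=] ->.
set u1 := w1 *m _; set u2 := w2 *m _.
have u1a : (u1 <= eigenspace T a)%MS by exact: submxMl.
have u2s : (u2 <= \sum_(b <- s) eigenspace T b)%MS by exact: submxMl.
have u12 := eigenspace_orth a s u1 u2 a_s u1a u2s.
have le_u2 : inner (u2 *m T) u2 <= delta * inner u2 u2.
  by apply: IHs => // b bs; apply: le_s; rewrite in_cons bs orbT.
have {u1a} u1a : u1 *m T = a *: u1 by exact/eigenspaceP.
have u21 : inner (u2 *m T) u1 = 0.
  by rewrite inner_mulmx T_sym u1a innerZr innerC u12 mulr0.
rewrite mulmxDl !(innerDl, innerDr) u21 u1a !innerZl u12 (innerC u2 u1) u12.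
rewrite mulr0 !(addr0, add0r) mulrDr; apply: lerD => //.
by apply: ler_wpM2r; [exact: inner_ge0|apply: (le_s a); rewrite mem_head].
Qed.

Lemma rayleigh_spectral_subspace (delta : R) u :
  (u <= spectral_subspace T delta)%MS -> inner (u *m T) u <= delta * inner u u.
Proof.
apply: rayleigh_eigenspaces; first exact: finite_support_uniq.
(* An infinite support would give the empty list; a finite one lists points of [[0, delta]]. *)
case: finite_supportP => [_ a|X sX _ _ a /sX /andP[]//].
by rewrite in_nil.
Qed.

End Inner.

(** * Attained extrema on a nonempty finite type *)

Lemma maximum_range {R : realType} {V : finType} (f : V -> R) (x : V) :
  exists2 y, maximum (range f) = f y & forall z, f z <= f y.
Proof.
have [y _ f_y] := arg_maxP f (erefl : xpredT x).
exists y => [|z]; last exact: f_y.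
by apply: maximumE => [|_ [z _ <-]]; [exists y|exact: f_y].
Qed.

Lemma minimum_range {R : realType} {V : finType} (f : V -> R) (x : V) :
  exists2 y, minimum (range f) = f y & forall z, f y <= f z.
Proof.
have [y _ f_y] := arg_minP f (erefl : xpredT x).
exists y => [|z]; last exact: f_y.
by apply: minimumE => [|_ [z _ <-]]; [exists y|exact: f_y].
Qed.

(** * The signless Laplacian, its Green function and the value of [graphK] *)

Section SignlessLaplacian.
Context {R : realType} {V : finType} {e : rel V}.
Hypotheses (e_sym : symmetric e) (e_irr : irreflexive e).
Hypotheses (e_conn : forall u v : V, connect e u v) (e_nbip : ~ bipartite e).
Local Notation T := (signless_laplacian R e).
Implicit Types (u w : 'rV[R]_#|V|) (x y z : V).

Definition vertex_fun u y : R := u 0 (enum_rank y).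

Lemma signless_laplacian_sym : T^T = T.
Proof.
apply/matrixP => i j; rewrite !mxE e_sym; congr (_ + _).
by rewrite eq_sym; case: eqVneq => // ->.
Qed.

Lemma vertex_fun_mulmx u z :
  vertex_fun (u *m T) z = \sum_(v | e z v) (vertex_fun u z + vertex_fun u v).
Proof.
rewrite /vertex_fun mulmxDr mxE mul_mx_diag mxE big_split /=; congr (_ + _).
  by rewrite mxE enum_rankK sumr_const mulr_natr.
rewrite mxE (reindex (@enum_rank V)) /=; last by apply: onW_bij; exact: enum_rank_bij.
rewrite [RHS]big_mkcond; apply: eq_bigr => v _.
by rewrite mxE !enum_rankK e_sym; case: (e z v); rewrite ?mulr1 ?mulr0.
Qed.

Lemma inner_signless_laplacian u :
  inner (u *m T) u = edge_energy e (vertex_fun u).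
Proof.
suff : inner (u *m T) u *+ 2 = edge_energy e (vertex_fun u) *+ 2.
  by move/eqP; rewrite eqrMn2r => /eqP.
rewrite edge_energy_double // /inner (reindex (@enum_rank V)) /=; last first.
  by apply: onW_bij; exact: enum_rank_bij.
set f := vertex_fun u.
have -> : \sum_z (u *m T) 0 (enum_rank z) * u 0 (enum_rank z) =
    \sum_z \sum_(v | e z v) (f z + f v) * f z.
  apply: eq_bigr => z _; rewrite -mulr_suml; congr (_ * _).
  exact: vertex_fun_mulmx.
rewrite mulr2n.
(* Swapping the ends of each edge in one copy lets the two copies add up to squares. *)
have {2}-> : \sum_z \sum_(v | e z v) (f z + f v) * f z =
    \sum_z \sum_(v | e z v) (f z + f v) * f v.
  rewrite (exchange_big_dep xpredT) //=; apply: eq_bigr => z _.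
  by apply: eq_big => [v|v _]; [rewrite e_sym|rewrite addrC].
rewrite -big_split; apply: eq_bigr => z _; rewrite -big_split.
by apply: eq_bigr => v _; rewrite /= -mulrDr expr2.
Qed.

Lemma sqr_vertex_fun_le_diam u y :
  vertex_fun u y ^+ 2 <= ((diam e)%:R + 1) * inner (u *m T) u.
Proof. by rewrite inner_signless_laplacian; exact: sqr_le_diam. Qed.

(** A kernel vector has zero energy, so the diameter bound kills it at every vertex. *)
Lemma signless_laplacian_unit : T \in unitmx.
Proof.
rewrite -row_free_unit -kermx_eq0; apply/rowV0P => u /sub_kermxP uT.
apply/rowP => i; rewrite mxE; apply/eqP.
have := sqr_vertex_fun_le_diam u (enum_val i).
rewrite uT innerE mul0mx mxE mulr0 /vertex_fun enum_valK.
by rewrite real_exprn_even_le0 ?num_real.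
Qed.

Definition green y : 'rV[R]_#|V| := indicator R y *m invmx T.

Lemma green_mul y : green y *m T = indicator R y.
Proof. by rewrite mulmxKV // signless_laplacian_unit. Qed.

Lemma inner_green u y : inner (u *m T) (green y) = vertex_fun u y.
Proof.
by rewrite inner_mulmx signless_laplacian_sym green_mul inner_delta.
Qed.

(** The best constant [c] in [f y ^+ 2 <= c * edge_energy e f]. *)
Definition green_diag y : R := vertex_fun (green y) y.

Lemma energy_green y : edge_energy e (vertex_fun (green y)) = green_diag y.
Proof. by rewrite -inner_signless_laplacian inner_green. Qed.

Lemma green_diag_gt0 y : 0 < green_diag y.
Proof.
rewrite lt_neqAle -{2}energy_green edge_energy_ge0 andbT eq_sym.
apply/negP => /eqP c0.
have g0 : green y = 0.
  apply/rowP => i; rewrite [RHS]mxE; apply/eqP.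
  have := sqr_vertex_fun_le_diam (green y) (enum_val i).
  rewrite inner_green -/(green_diag y) c0 mulr0 /vertex_fun enum_valK.
  by rewrite real_exprn_even_le0 ?num_real.
have := congr1 (vertex_fun^~ y) (green_mul y).
by rewrite g0 mul0mx /vertex_fun !mxE !eqxx => /eqP; rewrite eq_sym oner_eq0.
Qed.

(* Cauchy-Schwarz for the inner product defined by the Laplacian, applied to
   [u] and [green y]. *)
Lemma sqr_vertex_fun_le_green u y :
  vertex_fun u y ^+ 2 <= green_diag y * edge_energy e (vertex_fun u).
Proof.
set c := green_diag y; set a := vertex_fun u y; set E := edge_energy _ _.
have c0 : 0 < c := green_diag_gt0 y.
have := edge_energy_ge0 (e := e) (vertex_fun (c *: u + (- a) *: green y)).
rewrite -inner_signless_laplacian mulmxDl -!scalemxAl.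
rewrite !(innerDl, innerDr, innerZl, innerZr) green_mul inner_green.
rewrite inner_signless_laplacian -/E -/a.
rewrite (innerC _ u) (innerC _ (green y)) !inner_delta.
rewrite -/(vertex_fun u y) -/(vertex_fun (green y) y) -/a -/(green_diag y) -/c.
have -> : c * (c * E + - a * a) + - a * (c * a + - a * c) =
  c * (c * E - a ^+ 2) by ring.
by rewrite pmulr_rge0 // subr_ge0.
Qed.

Lemma fun_sqr_le_green (f : V -> R) y :
  f y ^+ 2 <= green_diag y * edge_energy e f.
Proof.
have := sqr_vertex_fun_le_green (\row_i f (enum_val i)) y.
have -> // : vertex_fun (\row_i f (enum_val i)) = f.
by apply/funext => z; rewrite /vertex_fun mxE enum_rankK.
Qed.

(** At a neighbour [z] of [y] the Laplacian of [green y] is 0, yet if [green y] were nonnegative the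
    edge to [y] would contribute at least [green_diag y > 0]. *)
Lemma green_sign_change y : exists z, vertex_fun (green y) z < 0.
Proof.
apply: contrapT => /forallNP g_ge0.
have {}g_ge0 z : 0 <= vertex_fun (green y) z by rewrite leNgt; exact/negP.
have gTE z : \sum_(v | e z v) (vertex_fun (green y) z + vertex_fun (green y) v)
    = (z == y)%:R.
  rewrite -vertex_fun_mulmx green_mul /vertex_fun mxE eqxx /=.
  by rewrite (inj_eq enum_rank_inj).
have [z yz] : exists z, e y z.
  apply: contrapT => /forallNP yN; have := gTE y.
  rewrite big_pred0 => [|z]; last exact/negP.
  by rewrite eqxx => /eqP; rewrite eq_sym oner_eq0.
have z_neq_y : z != y by apply: contraTneq yz => ->; rewrite e_irr.
have := gTE z; rewrite (negbTE z_neq_y) (bigD1 y) 1?e_sym //=.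
apply/eqP; rewrite gt_eqF // ltr_wpDr //.
  by apply: sumr_ge0 => v _; rewrite addr_ge0.
by rewrite ltr_wpDl //; exact: green_diag_gt0.
Qed.

(* The sign condition in the definition of [graphK] is inactive: the
   unconstrained minimiser [green y0] changes sign. *)
Lemma graphKE y0 : (forall y, green_diag y <= green_diag y0) ->
  graphK R e = (green_diag y0)^-1.
Proof.
move=> max_y0; have c0 := green_diag_gt0 y0; set c := green_diag y0 in c0 *.
apply: minimumE.
  exists (vertex_fun (green y0)) => /=.
    have [b -> ge_b] := maximum_range (vertex_fun (green y0)) y0.
    have [z gz] := green_sign_change y0.
    have [a -> le_a] := minimum_range (vertex_fun (green y0)) y0.
    by rewrite (le_lt_trans (le_a z) gz) (lt_le_trans c0 (ge_b y0)).
  rewrite energy_green -/c (_ : maximum _ = c ^+ 2).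
    by rewrite expr2 invfM mulrA mulfV ?mul1r // gt_eqF.
  apply: maximumE; first by exists y0; rewrite // real_normK ?num_real.
  (* The square at [z] is at most [green_diag z * c], and [green_diag z <= c] by the choice of
     [y0]. *)
  move=> _ [z _ <-]; rewrite real_normK ?num_real //.
  apply: le_trans (fun_sqr_le_green _ z) _.
  by rewrite energy_green expr2 ler_pM2r.
move=> _ [f /= /andP[_ f_gt0] <-].
have [y ->] := maximum_range (fun y => `|f y| ^+ 2) y0.
have [b fb _] := maximum_range f y0; rewrite fb in f_gt0 => max_y.
have y_gt0 : 0 < `|f y| ^+ 2.
  by apply: lt_le_trans (max_y b); rewrite exprn_gt0 // normr_gt0 gt_eqF.
rewrite ler_pdivlMr // mulrC ler_pdivrMr // mulrC real_normK ?num_real //.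
apply: le_trans (fun_sqr_le_green f y) _.
by apply: ler_wpM2r; rewrite ?edge_energy_ge0.
Qed.

End SignlessLaplacian.

(** * The two inequalities *)

Theorem proposition1p9 (R : realType) (V : finType) (e : rel V)
    (e_sym : symmetric e) (e_irr : irreflexive e)
    (e_conn : forall u v : V, connect e u v)
    (e_nbip : ~ bipartite e)
    (delta : R) (x : V) :
  0 <= delta < max_eigenvalue (signless_laplacian R e) ->
  spectral_measure (signless_laplacian R e) x delta <= delta / graphK R e /\
  delta / graphK R e <= ((diam e)%:R + 1) * delta.
Proof.
case/andP => delta_ge0 _.
have [y0 _ max_y0] := maximum_range (green_diag (R := R) (e := e)) x.
have c0 : 0 < green_diag (R := R) (e := e) y0 by exact: green_diag_gt0.
rewrite (graphKE e_sym e_irr e_conn e_nbip y0 max_y0) invrK.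
split; last first.
  rewrite mulrC; apply: ler_wpM2r => //.
  (* Multiplied by [green_diag y0], this is the diameter bound for [green y0] at [y0], as its energy
     is [green_diag y0]. *)
  rewrite -(ler_pM2r c0) -expr2.
  rewrite -{2}(energy_green e_sym e_irr e_conn e_nbip).
  exact: (sqr_le_diam e_sym e_irr e_conn e_nbip (vertex_fun (green y0)) y0).
rewrite /spectral_measure /spectral_proj.
set W := spectral_subspace _ delta; set f := _ *m orth_proj W.
have [fW f_orth] := orth_proj_spec W (indicator R x).
have fx : inner f (indicator R x) = vertex_fun f x by exact: inner_delta.
(* [f] lies in [W], hence is orthogonal to [indicator R x - f]. *)
have ff : inner f f = vertex_fun f x.
  apply/esym/eqP; rewrite -fx innerC -subr_eq0.
  by have := f_orth f fW; rewrite innerDl -scaleN1r innerZl mulN1r => ->.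
have le_energy : edge_energy e (vertex_fun f) <= delta * vertex_fun f x.
  rewrite -inner_signless_laplacian // -ff.
  exact/rayleigh_spectral_subspace/fW/signless_laplacian_sym.
(* The final estimate is divided by [f] at [x], so the value 0 is treated apart. *)
rewrite fx; have := inner_ge0 f; rewrite ff le_eqVlt => /predU1P[<-|fx_gt0].
  by rewrite mulr_ge0 // ltW.
rewrite -(ler_pM2r fx_gt0) -expr2.
apply: le_trans (fun_sqr_le_green e_sym e_irr e_conn e_nbip (vertex_fun f) x) _.
rewrite mulrC mulrAC; apply: ler_pM => //; first exact: edge_energy_ge0.
by apply: ltW; exact: green_diag_gt0.
Qed.
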